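(* Let $N\in\mathbb{N}_0$ and $a\in\mathbb{R}$. For every $z,w\in\mathbb{C}$, $$S_{a,N}(z,w)=e^{-\frac{a^2}{4}+\frac{za}{\sqrt2}}\,K_{N+1}\left(z-\frac{a}{\sqrt2},w\right).$$
   Context: The Hermite polynomials $H_m$ are defined by $e^{2xz-z^2}=\sum_{m\ge0}\frac{H_m(x)}{m!}z^m$, and the Segal–Bargmann kernel is $A_z(x)=\pi^{-1/4}e^{-\frac12(x^2+z^2)+\sqrt2zx}$, $z\in\mathbb{C}$, $x\in\mathbb{R}$. For $m\in\mathbb{N}_0$, $a\in\mathbb{R}$, $z,w\in\mathbb{C}$, $$I_{a,m}(z,w):=\int_{\mathbb{R}}H_m\left(\frac{z+\overline{z}}{\sqrt2}-x\right)H_m\left(\frac{w+\overline{w}}{\sqrt2}-x+a\right)A_z(x)\,\overline{A_w(x-a)}\,dx,$$ and $S_{a,N}(z,w)=\sum_{m=0}^{N}\frac{1}{2^mm!}I_{a,m}(z,w)$. The polyanalytic Fock kernel of order $N\ge1$ is $K_N(z,w)=e^{z\overline{w}}L^1_{N-1}(|z-w|^2)$, where $L^\beta_k(x)=\sum_{j=0}^{k}(-1)^j\binom{k+\beta}{k-j}\frac{x^j}{j!}$. *)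

(* Defs.v *)
From HB Require Import structures.
From mathcomp Require Import all_boot all_order all_algebra.
From mathcomp Require Import ring lra.
From mathcomp Require Import complex.
From mathcomp Require Import all_classical all_reals all_analysis.
Set Implicit Arguments.
Unset Strict Implicit.
Unset Printing Implicit Defensive.
Import Order.TTheory GRing.Theory Num.Theory.
Import numFieldNormedType.Exports.

Local Open Scope classical_set_scope.
Local Open Scope ring_scope.
Local Open Scope complex_scope.

Definition expC (R : realType) (z : R[i]) : R[i] :=
  (expR (complex.Re z))%:C * (cos (complex.Im z) +i* sin (complex.Im z)).

Definition Cintegral (R : realType) (f : R -> R[i]) : R[i] :=
  (\int[@lebesgue_measure R]_(x in setT) complex.Re (f x))%R
  +i* (\int[@lebesgue_measure R]_(x in setT) complex.Im (f x))%R.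

(* The generating function determines H uniquely; is_hermite_ex shows that such
   a family exists. *)
Definition is_hermite (R : realType) (H : nat -> {poly R}) : Prop :=
  forall x z : R,
    pseries (fun m => (H m).[x] / m`!%:R) z @ \oo --> expR (2 * x * z - z ^+ 2).

(* The pair (H_n, H_(n+1)), by the three-term recurrence. *)
Fixpoint hermite_pair (R : realType) (n : nat) : {poly R} * {poly R} :=
  if n is m.+1 then
    let: (p, q) := hermite_pair R m in (q, 2 *: 'X * q - (2 * m.+1%:R) *: p)
  else (1, 2 *: 'X).

Definition entire_coef (R : realType) (c : R^nat) : Prop :=
  forall r, 0 < r -> exists M : R, forall m, `|c m| * r ^+ m <= M.

Lemma entire_coef_cvg (R : realType) (c : R^nat) (z : R) :
  entire_coef c -> cvgn (pseries c z).
Proof.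
move=> bc; have r0 : 0 < `|z| + 1 by rewrite ltr_wpDl.
have [M hM] := bc _ r0.
have M0 : 0 <= M by have := hM 0%N; rewrite expr0 mulr1; apply: le_trans.
apply: normed_cvg; rewrite /normed_series_of /=.
apply: (@series_le_cvg _ _ (geometric M (`|z| / (`|z| + 1)))) => [//||n|].
- by move=> n; rewrite /geometric /= mulr_ge0 ?exprn_ge0 ?divr_ge0 // ltW.
- rewrite /geometric /= normrM normrX expr_div_n mulrA ler_pdivlMr ?exprn_gt0 //.
  by rewrite mulrAC ler_wpM2r ?exprn_ge0.
- apply: is_cvg_geometric_series.
  by rewrite ger0_norm ?divr_ge0 ?(ltW r0) // ltr_pdivrMr // mul1r ltrDl.
Qed.

Lemma entire_coef_diffs (R : realType) (c : R^nat) :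
  entire_coef c -> entire_coef (pseries_diffs c).
Proof.
move=> bc r r0; have r20 : 0 < 2 * r by rewrite mulr_gt0.
have [M hM] := bc _ r20; exists (M / r) => m.
rewrite ler_pdivlMr // -mulrA -exprSr /pseries_diffs normrM normr_nat.
apply: le_trans (hM m.+1); rewrite exprMn mulrA ler_wpM2r ?exprn_ge0 ?(ltW r0) //.
by rewrite mulrC ler_wpM2l // -natrX ler_nat ltnW // ltn_expl.
Qed.

Lemma is_hermite_ex (R : realType) : exists H : nat -> {poly R}, is_hermite H.
Proof.
exists (fun n => (hermite_pair R n).1).
move=> x.
set c := fun m => _ / _.
have c0 : c 0%N = 1 by rewrite /c /= hornerE fact0 divr1.
have c1 : c 1%N = 2 * x by rewrite /c /= !hornerE divr1.
have cS m : m.+2%:R * c m.+2 = 2 * x * c m.+1 - 2 * c m.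
  rewrite /c /=; case: (hermite_pair R m) => p q /=.
  rewrite !(hornerD, hornerN, hornerM, hornerZ, hornerX) !factS !natrM.
  by field; rewrite nat1r -natrD !pnatr_eq0 -lt0n fact_gt0.
have bc : entire_coef c.
  move=> r r0; pose K := 2 * `|x| * r + 2 * r ^+ 2.
  have [k hk] : exists k : nat, K <= k%:R.
    by exists (Num.truncn K).+1; rewrite ltW // truncnS_gt.
  pose b m := `|c m| * r ^+ m.
  pose M := \sum_(i < k.+2) b i.
  have b0 i : 0 <= b i by rewrite mulr_ge0 ?exprn_ge0 ?(ltW r0).
  have hM i : (i < k.+2)%N -> b i <= M.
    move=> hi; rewrite /M (bigD1 (Ordinal hi)) //= lerDl sumr_ge0 //.
  suff hb m : b m <= M /\ b m.+1 <= M by exists M => m; have [] := hb m.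
  elim: m => [|m [ih1 ih2]]; first by split; exact: hM.
  split=> //; have [mk|km] := leqP m.+3 k.+2; first exact: hM.
  have M0 : 0 <= M by apply: le_trans ih2.
  have hm : 0 < m.+2%:R :> R by rewrite ltr0n.
  rewrite -(ler_pM2l hm).
  have -> : m.+2%:R * b m.+2 = `|m.+2%:R * c m.+2| * r ^+ m.+2.
    by rewrite normrM normr_nat mulrA.
  rewrite cS; apply: (@le_trans _ _ (K * M)); last first.
    by rewrite ler_wpM2r // (le_trans hk) // ler_nat ltnW // ltnW.
  apply: (@le_trans _ _ (2 * `|x| * r * b m.+1 + 2 * r ^+ 2 * b m)); last first.
    rewrite /K [leRHS]mulrDl lerD // ler_wpM2l //.
    - by rewrite !mulr_ge0 // ltW.
    - by rewrite mulr_ge0 // exprn_ge0 // ltW.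
  apply: (@le_trans _ _ ((2 * `|x| * `|c m.+1| + 2 * `|c m|) * r ^+ m.+2)).
    rewrite ler_wpM2r ?exprn_ge0 ?(ltW r0) // (le_trans (ler_normB _ _)) //.
    by rewrite !normrM normr_nat.
  by rewrite /b !exprS le_eqVlt; apply/orP; left; apply/eqP; ring.
pose f (z : R) : R := limn (pseries c z).
have df (z : R) : is_derive z (1 : R) f ((2 * x - 2 * z) * f z).
  have -> : (2 * x - 2 * z) * f z = limn (pseries (pseries_diffs c) z).
    apply/esym/cvg_lim => //.
    have E n : \sum_(0 <= i < n.+1) pseries_diffs c i * z ^+ i =
        2 * x * (\sum_(0 <= i < n.+1) c i * z ^+ i) -
        2 * z * (\sum_(0 <= i < n) c i * z ^+ i).
      elim: n => [|n ih].
        rewrite !big_nat1 big_geq // /pseries_diffs c0 c1 expr0.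
        by rewrite mulr1n !mul1r !mulr1 mulr0 subr0.
      rewrite big_nat_recr //= ih.
      rewrite (big_nat_recr n.+1) //= !(big_nat_recr n) //=.
      rewrite /pseries_diffs cS exprS.
      ring.
    have cz : pseries c z @ \oo --> f z by exact: entire_coef_cvg.
    have E' : (fun n => pseries (pseries_diffs c) z n.+1) = (fun n =>
        2 * x * pseries c z n.+1 - 2 * z * pseries c z n).
      exact/funext.
    rewrite -cvg_shiftS /= E' mulrBl; apply: cvgB; apply: cvgMl_tmp => //.
    by rewrite cvg_shiftS.
  apply: (@pseries_snd_diffs _ _ (`|z| + 1)).
  - exact: entire_coef_cvg.
  - exact/entire_coef_cvg/entire_coef_diffs.
  - exact/entire_coef_cvg/entire_coef_diffs/entire_coef_diffs.
  - by rewrite [ltRHS]ger0_norm // ltrDl.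
have f0 : f 0 = 1.
  apply/cvg_lim => //; rewrite -cvg_shiftS /=.
  rewrite (_ : (fun _ => _) = cst 1); first exact: cvg_cst.
  apply/funext => n; rewrite /pseries /series /= big_nat_recl //= expr0 mulr1 c0.
  by rewrite big1 ?addr0 // => i _; rewrite exprS mul0r mulr0.
move=> z; suff <- : f z = expR (2 * x * z - z ^+ 2) by exact: entire_coef_cvg.
have hg (y : R) : is_derive y (1 : R) (fun t : R => f t * expR (t ^+ 2 - 2 * x * t)) 0.
  have du : is_derive y (1 : R) (fun t : R => t ^+ 2 - 2 * x * t) (2 * y - 2 * x).
    by apply: is_derive_eq; rewrite /GRing.scale /=; ring.
  pose u t : R := t ^+ 2 - 2 * x * t.
  have de : is_derive y (1 : R) (expR \o u) (expR (u y) * (2 * y - 2 * x)).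
    by apply: is_derive1_comp.
  have dg := is_deriveM (df y) de.
  apply: (is_derive_eq dg); rewrite /GRing.scale /=; ring.
have := @is_derive_0_is_cst _ _ z 0 hg.
rewrite f0 expr0n /= !mulr0 subr0 expR0 mulr1 => h.
apply: (@mulIf _ (expR (z ^+ 2 - 2 * x * z))); first by rewrite expR_eq0.
by rewrite h -expRD -[LHS]expR0; congr expR; ring.
Qed.

Definition laguerre (F : fieldType) (beta k : nat) : {poly F} :=
  \sum_(j < k.+1) ((-1) ^+ j * 'C(k + beta, k - j)%:R / j`!%:R) *: 'X^j.

Definition segal_bargmann (R : realType) (z : R[i]) (x : R) : R[i] :=
  (pi `^ (- 4^-1))%:C *
  expC (- 2^-1 * (x%:C ^+ 2 + z ^+ 2) + (Num.sqrt 2)%:C * z * x%:C).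

(* The arguments of H_m are formed in R[i] and have zero imaginary part, so the
   real polynomial H_m is mapped to R[i]. *)
Definition I_int (R : realType) (H : nat -> {poly R}) (a : R) (m : nat)
    (z w : R[i]) : R[i] :=
  let Hm := map_poly (real_complex R) (H m) in
  Cintegral (fun x : R =>
    Hm.[(z + z^*) / (Num.sqrt 2)%:C - x%:C] *
    Hm.[(w + w^*) / (Num.sqrt 2)%:C - x%:C + a%:C] *
    segal_bargmann z x * (segal_bargmann w (x - a))^*).

Definition S_sum (R : realType) (H : nat -> {poly R}) (a : R) (N : nat)
    (z w : R[i]) : R[i] :=
  \sum_(m < N.+1) (2 ^+ m * m`!%:R)^-1 * I_int H a m z w.

(* Meaningful for 0 < N only. *)
Definition fock_kernel (R : realType) (N : nat) (z w : R[i]) : R[i] :=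
  expC (z * w^*) * (laguerre R[i] 1 N.-1).[`|z - w| ^+ 2].

(* Main.v *)
Require Import Defs.
From HB Require Import structures.
From mathcomp Require Import all_boot all_order all_algebra.
From mathcomp Require Import ring lra.
From mathcomp Require Import complex.
From mathcomp Require Import all_classical all_reals all_analysis.
From mathcomp Require Import measurable_realfun.

(** Write p = (z + z^* )/sqrt 2, q = (w + w^* )/sqrt 2 + a and
b = a + sqrt 2 (z + w^* ).  Both Segal-Bargmann kernels are Gaussian
exponentials, so the integrand of I_{a,m}(z,w) is, up to a constant factor,
H_m(p - x) H_m(q - x) exp(-x^2 + b x).  The integral is thus the value at the
polynomial H_m(p - X) H_m(q - X) of the linear functional
L(P) = int P(x) exp(-x^2 + b x) dx, with b complex.

Two facts determine L.  Integrating the derivative of P(x) exp(-x^2 + b x) over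
the line gives L(X P) = (b/2) L(P) + L(P')/2 (wave_functional_mulX), and
L(1) = sqrt pi exp(b^2/4) (wave_functional1).  The second fact needs no contour
shift: as a function of r in [0,1], the integral J of exp(-x^2 + r b x) satisfies
J' = (r b^2/2) J, by differentiation under the integral and the first fact, and
J(0) is the Gauss integral.

The rest is algebra.  With H_{m+1} = 2 X H_m - 2 m H_{m-1} and
H_m' = 2 m H_{m-1}, both extracted from the generating function by uniqueness of
power series coefficients, the numbers D(m,n) = L(H_m(p - X) H_n(q - X)) satisfy
D(m+1,n) = 2 s D(m,n) + 2 n D(m,n-1), where s = p - b/2 and t = q - b/2, and
symmetrically in n.  Solving the recurrence, D(m,m)/(2^m m!) = L(1) times the
Laguerre polynomial L_m at -2 s t, and summing over m <= N turns these into
L^1_N by the hockey-stick identity.  Finally -2 s t = |z - a/sqrt 2 - w|^2, and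
the constants combine to the exponential of the right-hand side. *)

Import Order.TTheory GRing.Theory Num.Theory.
Import numFieldNormedType.Exports.

Local Open Scope classical_set_scope.
Local Open Scope ring_scope.
Local Open Scope complex_scope.

Set Implicit Arguments.
Unset Strict Implicit.
Unset Printing Implicit Defensive.

(** * Hermite polynomials from their generating function *)

Lemma cvgn_unique (R : realType) (u : R^nat) (l l' : R) :
  u @ \oo --> l -> u @ \oo --> l' -> l = l'.
Proof.
move=> ul ul'; rewrite -(@cvg_lim _ (@Rhausdorff R) _ _ _ _ _ ul).
by rewrite (@cvg_lim _ (@Rhausdorff R) _ _ _ _ _ ul').
Qed.

(** The terms of a convergent series are bounded, and the bound at radius r is
exactly the estimate asked by entire_coef.  Convergence everywhere thus gives
free access to termwise differentiation. *)
Lemma cvg_pseries_entire (R : realType) (c : R^nat) :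
  (forall z, cvgn (pseries c z)) -> entire_coef c.
Proof.
move=> cvc r r0.
have /cvg_series_cvg_0 c0 := cvc r.
have [M [_ hM]] := cvg_seq_bounded (cvgP _ c0).
exists (M + 1) => m; have := hM (M + 1) _ m I; rewrite ltrDl => /(_ ltr01).
by rewrite /= normrM normrX (ger0_norm (ltW r0)).
Qed.

Lemma pseries0 (R : realType) (c : R^nat) : pseries c 0 @ \oo --> c 0%N.
Proof.
rewrite -cvg_shiftS /= (_ : (fun _ => _) = cst (c 0%N)); first exact: cvg_cst.
apply/funext => n; rewrite /pseries /series /= big_nat_recl //= expr0 mulr1.
by rewrite big1 ?addr0 // => i _; rewrite exprS mul0r mulr0.
Qed.

(** Termwise differentiation, phrased for the sum f of the series rather than
for its limit expression, so that it can be compared with a known derivative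
of f. *)
Lemma is_derive_pseries (R : realType) (c : R^nat) (f : R -> R) (z : R) :
  (forall z, pseries c z @ \oo --> f z) ->
  is_derive z (1 : R) f (limn (pseries (pseries_diffs c) z)).
Proof.
move=> cf.
have ec : entire_coef c.
  by apply: cvg_pseries_entire => y; exact: (cvgP _ (cf y)).
have -> : f = fun y => limn (pseries c y).
  by apply/funext => y; apply/esym/cvg_lim => //; exact: cf.
apply: (@pseries_snd_diffs _ _ (`|z| + 1)).
- exact: entire_coef_cvg.
- exact/entire_coef_cvg/entire_coef_diffs.
- exact/entire_coef_cvg/entire_coef_diffs/entire_coef_diffs.
- by rewrite [ltRHS]ger0_norm ?ltrDl ?addr_ge0.
Qed.

Lemma cvg_pseries_diffs (R : realType) (c : R^nat) (f f' : R -> R) :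
  (forall z, pseries c z @ \oo --> f z) ->
  (forall z, is_derive z (1 : R) f (f' z)) ->
  forall z, pseries (pseries_diffs c) z @ \oo --> f' z.
Proof.
move=> cf df z.
have ec : entire_coef c.
  by apply: cvg_pseries_entire => y; exact: (cvgP _ (cf y)).
suff <- : limn (pseries (pseries_diffs c) z) = f' z.
  exact/entire_coef_cvg/entire_coef_diffs.
have d1 := is_derive_pseries z cf.
by rewrite -(@derive_val _ _ _ _ _ _ _ d1) (@derive_val _ _ _ _ _ _ _ (df z)).
Qed.

(** Evaluation at 0 gives c_0 = 0, and the differentiated series again sums to 0
everywhere, so induction over all sequences at once reaches every
coefficient. *)
Lemma pseries_eq0 (R : realType) (c : R^nat) :
  (forall z, pseries c z @ \oo --> (0 : R)) -> forall n, c n = 0.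
Proof.
move=> c0 n; elim: n c c0 => [|n ih] c c0.
  exact: cvgn_unique (@pseries0 _ c) (c0 0).
have /ih : forall z, pseries (pseries_diffs c) z @ \oo --> (0 : R).
  by apply: (cvg_pseries_diffs c0) => z; exact: is_derive_cst.
by move=> /eqP; rewrite /pseries_diffs mulf_eq0 pnatr_eq0 /= => /eqP.
Qed.

Lemma poly_ext (R : numDomainType) (p q : {poly R}) :
  (forall x, p.[x] = q.[x]) -> p = q.
Proof.
move=> pq; apply/eqP; rewrite -subr_eq0; apply/negPn/negP => pq0.
pose s := [seq i%:R : R | i <- iota 0 (size (p - q))].
have /(max_poly_roots pq0) : all (root (p - q)) s.
  by apply/allP => x _; rewrite /root !hornerE pq subrr.
rewrite map_inj_uniq ?iota_uniq => [/(_ isT)|m n /eqP].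
  by rewrite size_map size_iota ltnn.
by rewrite eqr_nat => /eqP.
Qed.

Lemma hermite0 (R : realType) (H : nat -> {poly R}) :
  is_hermite H -> H 0%N = 1.
Proof.
move=> hH; apply: poly_ext => x.
have := cvgn_unique (@pseries0 _ _) (hH x 0).
by rewrite mulr0 expr0n subr0 expR0 fact0 divr1 hornerE.
Qed.

(** The generating function f(z) = exp(2xz - z^2) satisfies f' = (2x - 2z) f;
this equation is the recurrence when read on coefficients.  For m = 0 the
truncated predecessor is harmless, since its coefficient is 0. *)
Lemma hermiteS (R : realType) (H : nat -> {poly R}) (m : nat) :
  is_hermite H -> H m.+1 = 2 *: 'X * H m - (2 * m%:R) *: H m.-1.
Proof.
move=> hH; apply: poly_ext => x.
pose c m := (H m).[x] / m`!%:R.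
(* the coefficients of z * f z *)
pose c' m := if m is k.+1 then c k else 0.
pose f (z : R) := expR (2 * x * z - z ^+ 2).
have cf z : pseries c z @ \oo --> f z by exact: hH.
have c'f z : pseries c' z @ \oo --> z * f z.
  rewrite -cvg_shiftS /= (_ : (fun _ => _) = (fun n => z * pseries c z n)).
    exact: cvgMl_tmp.
  apply/funext => n; rewrite /pseries /series /= big_nat_recl //= mul0r add0r.
  by rewrite mulr_sumr; apply: eq_bigr => i _; rewrite exprS; ring.
have df z : is_derive z (1 : R) f ((2 * x - 2 * z) * f z).
  have du : is_derive z (1 : R) (fun t : R => 2 * x * t - t ^+ 2) (2 * x - 2 * z).
    by apply: is_derive_eq; rewrite /GRing.scale /=; ring.
  have := @is_derive1_comp _ expR (fun t : R => 2 * x * t - t ^+ 2) z _ _ _ du.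
  by move=> /(_ _ (is_derive_expR _)) h; apply: (is_derive_eq h); rewrite mulrC.
have dcf := cvg_pseries_diffs cf df.
have /pseries_eq0 : forall z,
    pseries (fun k => pseries_diffs c k - 2 * x * c k + 2 * c' k) z @ \oo --> (0 : R).
  move=> z; rewrite (_ : pseries _ z = fun n => pseries (pseries_diffs c) z n
      - 2 * x * pseries c z n + 2 * pseries c' z n); last first.
    apply/funext => n; rewrite /pseries /series /= !mulr_sumr -sumrN -!big_split /=.
    by apply: eq_bigr => i _; ring.
  have -> : 0 = (2 * x - 2 * z) * f z - 2 * x * f z + 2 * (z * f z) by ring.
  by apply: cvgD; [apply: cvgB => //|]; exact: cvgMl_tmp.
move=> /(_ m); rewrite /pseries_diffs /c' /c !hornerE.
case: m => [|m] /=.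
  rewrite !fact0 !divr1 mul1r !mulr0 addr0 mul0r subr0 => /eqP.
  by rewrite subr_eq0 => /eqP ->.
rewrite !factS !natrM => /(congr1 (fun t => m.+1%:R * m`!%:R * t)); rewrite mulr0.
have m0 : m`!%:R != 0 :> R by rewrite pnatr_eq0 -lt0n fact_gt0.
have m1 : m.+1%:R != 0 :> R by rewrite pnatr_eq0.
have m2 : m.+2%:R != 0 :> R by rewrite pnatr_eq0.
move: m0 m1 m2; move: m`!%:R m.+1%:R m.+2%:R => q r s q0 r0 s0 e.
apply/eqP; rewrite -subr_eq0; apply/eqP; apply: etrans e; field.
by rewrite q0 r0 s0.
Qed.

(** The derivative of the recurrence for H_{m+2} involves the derivatives of
H_{m+1} and H_m, whence the induction on two consecutive indices. *)
Lemma deriv_hermite (R : realType) (H : nat -> {poly R}) (m : nat) :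
  is_hermite H -> (H m)^`() = (2 * m%:R) *: H m.-1.
Proof.
move=> hH; suff: (H m)^`() = (2 * m%:R) *: H m.-1 /\
                 (H m.+1)^`() = (2 * m.+1%:R) *: H m by case.
elim: m => [|m [ih1 ih2]].
  rewrite (hermiteS _ hH) (hermite0 hH) mulr0 !scale0r subr0 mulr1.
  by rewrite derivZ derivX derivC mulr1.
split=> //; rewrite (hermiteS m.+1 hH).
rewrite derivB derivM !derivZ derivX ih1 ih2 /= (hermiteS m hH).
rewrite -!mul_polyC !polyCM; move: (H m) (H m.-1) => P Q.
rewrite -[m.+2%:R]natr1 polyCD; ring.
Qed.

(** * Functionals satisfying the Gaussian integration by parts *)

(** The hypothesis on L is what integration by parts gives for a Gaussian of
mean beta and variance 1/2.  Expanding h_{m+1}, the derivative of the first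
factor produced by L(X P) cancels the term with h_{m-1}; only the derivative of
the second factor survives. *)
Lemma gaussian_functional_rec (F : numFieldType) (L : {scalar {poly F}})
    (beta : F) (h : nat -> {poly F}) (p q : F) (m n : nat) :
  (forall P, L ('X * P) = beta * L P + L P^`() / 2) ->
  (forall m, h m.+1 = 2 *: 'X * h m - (2 * m%:R) *: h m.-1) ->
  (forall m, (h m)^`() = (2 * m%:R) *: h m.-1) ->
  L ((h m.+1 \Po (p%:P - 'X)) * (h n \Po (q%:P - 'X))) =
  2 * (p - beta) * L ((h m \Po (p%:P - 'X)) * (h n \Po (q%:P - 'X))) +
  2 * n%:R * L ((h m \Po (p%:P - 'X)) * (h n.-1 \Po (q%:P - 'X))).
Proof.
move=> hL hS dh.
pose X p := p%:P - 'X : {poly F}.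
have dX r k : (h k \Po X r)^`() = - (2 * k%:R) *: (h k.-1 \Po X r).
  rewrite deriv_comp dh comp_polyZ /X derivB derivC derivX sub0r.
  by rewrite mulrN1 scaleNr.
(* the recurrence of h at p - X, with the products by X isolated for hL *)
have e : (h m.+1 \Po X p) * (h n \Po X q) =
    (2 * p) *: ((h m \Po X p) * (h n \Po X q)) -
    2 *: ('X * ((h m \Po X p) * (h n \Po X q))) -
    (2 * m%:R) *: ((h m.-1 \Po X p) * (h n \Po X q)).
  rewrite hS comp_polyB comp_polyM !comp_polyZ comp_polyX.
  rewrite -!mul_polyC !polyCM.
  by move: (h m \Po X p) (h m.-1 \Po X p) (h n \Po X q) => A B C; rewrite /X; ring.
have LZ a P : L (a *: P) = a * L P by rewrite linearZ.
rewrite e !raddfB /= !LZ hL derivM !dX -(scalerAl _ (_ \Po _)).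
rewrite -(scalerAr _ (_ \Po _)) raddfD /= !LZ -/(X p) -/(X q).
by field.
Qed.

(** The k-th term of the solution of the recurrence above.  The operators
f_n -> 2s f_n and f_n -> 2n f_{n-1} commute, so the m-th power of their sum
applied to (2t)^n expands binomially; the falling factorial n (n-1) ... (n-k+1) comes from
lowering k times and vanishes for k > n, which makes truncated n - k
harmless. *)
Definition hermite_moment (F : numFieldType) (s t : F) (m n k : nat) : F :=
  'C(m, k)%:R * (n ^_ k)%:R * 2 ^+ k * (2 * s) ^+ (m - k) * (2 * t) ^+ (n - k).

(** The binomial theorem for commuting operators, in the form of Pascal's rule. *)
Lemma sum_hermite_momentS (F : numFieldType) (s t : F) (m n : nat) :
  \sum_(k < m.+2) hermite_moment s t m.+1 n k =
  2 * s * (\sum_(k < m.+1) hermite_moment s t m n k) +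
  2 * n%:R * (\sum_(k < m.+1) hermite_moment s t m n.-1 k).
Proof.
have -> : \sum_(k < m.+1) hermite_moment s t m n k =
    \sum_(k < m.+2) hermite_moment s t m n k.
  by rewrite [RHS]big_ord_recr /= {3}/hermite_moment bin_small // !mul0r addr0.
rewrite [LHS]big_ord_recl [X in _ * X + _]big_ord_recl /= mulrDr -addrA; congr (_ + _).
  by rewrite /hermite_moment !bin0 !ffactn0 !subn0 exprS; ring.
rewrite !mulr_sumr -big_split /=; apply: eq_bigr => -[k km] _ /=.
rewrite /hermite_moment /bump /= add1n binS natrD.
case: n => [|n] /=; first by rewrite ffact0n mulr0n !(mulr0, mul0r) addr0.
rewrite ffactSS natrM !subSS exprS.
have [lkm|] := ltnP k m; first by rewrite -(subnSK lkm) exprS; ring.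
by move=> lmk; rewrite (@bin_small m k.+1) //; ring.
Qed.

(** The recurrence lowers m to 0; at m = 0 exchanging the two factors lets the
same recurrence lower n. *)
Lemma gaussian_functional_hermite (F : numFieldType) (L : {scalar {poly F}})
    (beta : F) (h : nat -> {poly F}) (p q : F) (m n : nat) :
  (forall P, L ('X * P) = beta * L P + L P^`() / 2) ->
  h 0%N = 1 ->
  (forall m, h m.+1 = 2 *: 'X * h m - (2 * m%:R) *: h m.-1) ->
  (forall m, (h m)^`() = (2 * m%:R) *: h m.-1) ->
  L ((h m \Po (p%:P - 'X)) * (h n \Po (q%:P - 'X))) =
  L 1 * \sum_(k < m.+1) hermite_moment (p - beta) (q - beta) m n k.
Proof.
move=> hL h0 hS dh; have rec := gaussian_functional_rec _ _ _ _ hL hS dh.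
elim: m n => [|m ih] n; last first.
  by rewrite rec !ih sum_hermite_momentS; ring.
rewrite big_ord1 /hermite_moment bin0 ffactn0 !subn0 !expr0 !mul1r.
elim: n => [|n ih]; first by rewrite h0 -polyC1 !comp_polyC polyC1 expr0 !mulr1.
rewrite (mulrC (h 0%N \Po _)) rec mulr0 mul0r addr0 (mulrC (h n \Po _)) ih.
by rewrite exprS; ring.
Qed.

Lemma sum_bin_hockey (N j : nat) : (\sum_(m < N.+1) 'C(m, j) = 'C(N.+1, j.+1))%N.
Proof.
elim: N => [|N ih]; first by rewrite big_ord1 binS [_ j.+1]bin_small.
by rewrite big_ord_recr /= ih [RHS]binS addnC.
Qed.

(** Reversing k to j = m - k turns the m-th inner sum into the Laguerre
polynomial of parameter 0 at -2st, and summing binomials over m raises the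
parameter to 1. *)
Lemma sum_hermite_moment_laguerre (F : numFieldType) (s t : F) (N : nat) :
  \sum_(m < N.+1) (2 ^+ m * m`!%:R)^-1 * \sum_(k < m.+1) hermite_moment s t m m k =
  (laguerre F 1 N).[- (2 * s * t)].
Proof.
have fact0 n : n`!%:R != 0 :> F by rewrite pnatr_eq0 -lt0n fact_gt0.
have diag m : (2 ^+ m * m`!%:R)^-1 * \sum_(k < m.+1) hermite_moment s t m m k =
    \sum_(j < m.+1) 'C(m, j)%:R * (2 * s * t) ^+ j / j`!%:R.
  rewrite mulr_sumr (reindex_inj rev_ord_inj) /=; apply: eq_bigr => -[j jm] _ /=.
  rewrite ltnS in jm; rewrite subSS /hermite_moment subKn // bin_sub //.
  have e : m`!%:R = (m ^_ (m - j))%:R * j`!%:R :> F.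
    by rewrite -natrM -(ffact_fact (leq_subr j m)) subKn.
  have f0 : (m ^_ (m - j))%:R != 0 :> F by rewrite pnatr_eq0 -lt0n ffact_gt0 leq_subr.
  have e2 : 2 ^+ m = 2 ^+ (m - j) * 2 ^+ j :> F by rewrite -exprD subnK.
  rewrite e e2 !exprMn; field.
  by rewrite f0 fact0 !expf_neq0.
under eq_bigr do rewrite diag.
have -> : \sum_(m < N.+1) \sum_(j < m.+1) 'C(m, j)%:R * (2 * s * t) ^+ j / j`!%:R =
    \sum_(m < N.+1) \sum_(j < N.+1) 'C(m, j)%:R * (2 * s * t) ^+ j / j`!%:R :> F.
  apply: eq_bigr => -[m mN] _ /=.
  rewrite (big_ord_widen _ (fun j => 'C(m, j)%:R * (2 * s * t) ^+ j / j`!%:R) mN).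
  rewrite big_mkcond; apply: eq_bigr => j _; case: ltnP => // mj.
  by rewrite bin_small // !mul0r.
rewrite exchange_big /= /laguerre horner_sum; apply: eq_bigr => -[j jN] _ /=.
rewrite -!mulr_suml -natr_sum sum_bin_hockey hornerZ hornerXn addn1.
have -> : 'C(N.+1, N - j) = 'C(N.+1, j.+1) by rewrite -(@bin_sub N.+1 j.+1) ?subSS.
have -> : (- (2 * s * t)) ^+ j = (-1) ^+ j * (2 * s * t) ^+ j by exact: exprNn.
have e : (-1) ^+ j * (-1) ^+ j = 1 :> F by rewrite -expr2 sqrr_sign.
by rewrite -[LHS]mul1r -[X in X * _ = _]e; ring.
Qed.

(** * Real Gaussian integrals with an oscillating factor *)

(** The fundamental theorem of calculus on [-n, n]: as n grows, the integral over
[-n, n] tends to the whole integral by dominated convergence, and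
F(n) - F(-n) tends to 0. *)
Lemma Rintegral_derive_eq0 (R : realType) (F f : R -> R) :
  (forall x, is_derive x (1 : R) F (f x)) -> continuous f ->
  (@lebesgue_measure R).-integrable setT (EFin \o f) ->
  F n%:R @[n --> \oo] --> (0 : R) -> F (- n%:R) @[n --> \oo] --> (0 : R) ->
  (\int[@lebesgue_measure R]_x f x)%R = 0.
Proof.
move=> dF cf fi Fp Fn.
pose I (n : nat) : set R := `[- n.+1%:R, n.+1%:R]%classic.
have FTC n : (\int[@lebesgue_measure R]_(x in I n) (f x)%:E =
    (F n.+1%:R - F (- n.+1%:R))%:E)%E.
  have cF : continuous F by move=> x; apply/differentiable_continuous/derivable1_diffP.
  rewrite EFinB; apply: continuous_FTC2.
  - by rewrite gtrN ?ltr0n.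
  - exact: continuous_subspaceT.
  - split.
    + by move=> x _.
    + exact/cvg_at_right_filter/cF.
    + exact/cvg_at_left_filter/cF.
  - by move=> x _; rewrite derive1E derive_val.
have lim1 : (\int[@lebesgue_measure R]_(x in I n) (f x)%:E)%E @[n --> \oo] -->
    (\int[@lebesgue_measure R]_x (f x)%:E)%E.
  have -> : (fun n => \int[@lebesgue_measure R]_(x in I n) (f x)%:E)%E =
      (fun n => \int[@lebesgue_measure R]_x (((EFin \o f) \_ (I n)) x))%E.
    by apply/funext => n; rewrite integral_mkcond.
  have [] // := @dominated_convergence _ _ _ (@lebesgue_measure R) setT measurableT
    (fun n => (EFin \o f) \_ (I n)) (EFin \o f) (fun x => `|(f x)%:E|%E).
  - move=> n; rewrite restrict_EFin; apply/measurable_EFinP.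
    have mf : measurable_fun setT f by exact: continuous_measurable_fun.
    have mI : measurable (I n) by exact: measurable_itv.
    exact: ((measurable_restrictT f mI).1 (measurable_funTS mf)).
  - exact: (measurable_int _ fi).
  - apply/aeW => x _; apply: cvg_near_cst; near=> n.
    rewrite patchE mem_set //= /I /= in_itv /= -ler_norml.
    rewrite (@le_trans _ _ n%:R) ?ler_nat //.
    by near: n; exact: nbhs_infty_ger.
  - exact: integrable_abse.
  - apply/aeW => x n _ /=; rewrite patchE; case: ifPn => //=.
    by rewrite normr0 lee_fin.
have lim2 : (\int[@lebesgue_measure R]_(x in I n) (f x)%:E)%E @[n --> \oo] --> 0%E.
  under eq_fun do rewrite FTC.
  apply: cvg_EFin; first exact: nearW.
  rewrite -[X in _ --> X](subr0 0); apply: cvgB.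
    by rewrite (cvg_shiftS (fun n => F n%:R)).
  by rewrite (cvg_shiftS (fun n => F (- n%:R))).
have e : (\int[@lebesgue_measure R]_x (f x)%:E)%E = 0%E.
  by rewrite -(@cvg_lim _ (@ereal_hausdorff R) _ _ _ _ _ lim1)
             (@cvg_lim _ (@ereal_hausdorff R) _ _ _ _ _ lim2).
by rewrite /Rintegral e.
Unshelve. all: end_near. Qed.

(** The phase phi treats cosine and sine at once: differentiating shifts it by
pi/2, so the real and imaginary parts of every complex identity below are two
values of phi in one real identity. *)
Definition osc_gauss (R : realType) (n : nat) (u v phi x : R) : R :=
  x ^+ n * expR (- x ^+ 2 + u * x) * cos (v * x + phi).

Lemma is_derive_osc_gauss (R : realType) (n : nat) (u v phi x : R) :
  is_derive x (1 : R) (osc_gauss n u v phi)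
    (n%:R * osc_gauss n.-1 u v phi x + u * osc_gauss n u v phi x
     - 2 * osc_gauss n.+1 u v phi x + v * osc_gauss n u v (phi + pi / 2) x).
Proof.
have d1 : is_derive x (1 : R) (fun y : R => - y ^+ 2 + u * y) (u - 2 * x).
  by apply: is_derive_eq; rewrite /GRing.scale /=; ring.
have d2 : is_derive x (1 : R) (fun y : R => v * y + phi) v.
  by apply: is_derive_eq; rewrite /GRing.scale /=; ring.
have d3 := @is_derive1_comp _ expR _ x _ _ (is_derive_expR _) d1.
have d4 := @is_derive1_comp _ cos _ x _ _ (is_derive_cos _) d2.
have d5 : is_derive x (1 : R) (fun y : R => y ^+ n) (n%:R * x ^+ n.-1).
  apply: DeriveDef; first exact: exprn_derivable.
  by rewrite exp_derive /GRing.scale /= mulr1.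
have := is_deriveM (is_deriveM d5 d3) d4.
move=> h; apply: (is_derive_eq h); rewrite /GRing.scale /= /osc_gauss.
rewrite !fctE /= addrA cosDpihalf (exprS x n); ring.
Qed.

Lemma continuous_osc_gauss (R : realType) (n : nat) (u v phi : R) :
  continuous (osc_gauss n u v phi).
Proof.
move=> x; have d := is_derive_osc_gauss n u v phi x.
exact/differentiable_continuous/derivable1_diffP.
Qed.

(** Absorb |x|^n into n! exp |x| and then complete the square in |x|, keeping
half of -x^2.  The bound is uniform for |u| <= U, as needed to differentiate
under the integral. *)
Lemma osc_gauss_bound (R : realType) (n : nat) (U u v phi x : R) :
  `|u| <= U ->
  `|osc_gauss n u v phi x| <=
    n`!%:R * expR ((U + 1) ^+ 2 / 2) * expR (- x ^+ 2 / 2).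
Proof.
move=> uU; rewrite /osc_gauss !normrM normrX (ger0_norm (expR_ge0 _)).
have f0 : 0 < n`!%:R :> R by rewrite ltr0n fact_gt0.
have h1 : `|x| ^+ n <= n`!%:R * expR `|x|.
  rewrite mulrC -ler_pdivrMr //; case: n {f0} => [|n].
    by rewrite expr0 fact0 divr1 -expR0 ler_expR.
  by apply: le_trans (expR_ge1Dxn n (normr_ge0 x)); rewrite lerDr.
have h2 : `|cos (v * x + phi)| <= 1 by rewrite ler_norml cos_geN1 cos_le1.
apply: (@le_trans _ _ (n`!%:R * expR `|x| * expR (- x ^+ 2 + u * x) * 1)).
  by rewrite !ler_pM ?mulr_ge0 ?exprn_ge0 ?expR_ge0.
rewrite mulr1 -!mulrA ler_wpM2l ?(ltW f0) // -!expRD ler_expR.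
have h3 : u * x <= U * `|x|.
  by rewrite (le_trans (ler_norm _)) // normrM ler_wpM2r.
(* the completed square *)
have h4 : 0 <= (U + 1 - `|x|) ^+ 2 by exact: sqr_ge0.
have h5 : `|x| ^+ 2 = x ^+ 2 by rewrite real_normK ?num_real.
nra.
Qed.

Lemma integrable_gauss_half (R : realType) :
  (@lebesgue_measure R).-integrable setT (EFin \o (fun x : R => expR (- x ^+ 2 / 2))).
Proof.
have := @integrable_normal_pdf R 0 1.
move=> /(integrableZl measurableT ((@normal_peak R 1)^-1)).
have p0 : normal_peak 1 != 0 :> R by rewrite gt_eqF // normal_peak_gt0 ?oner_neq0.
congr (_.-integrable _ _); apply/funext => x /=.
rewrite normal_pdfE ?oner_neq0 // /normal_fun -EFinM mulKf //.
by rewrite subr0 expr1n.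
Qed.

Lemma integrable_osc_gauss (R : realType) (n : nat) (u v phi : R) :
  (@lebesgue_measure R).-integrable setT (EFin \o osc_gauss n u v phi).
Proof.
pose C := n`!%:R * expR ((`|u| + 1) ^+ 2 / 2) : R.
have gi := integrableZl measurableT C (@integrable_gauss_half R).
apply: (le_integrable measurableT _ _ gi).
  apply/measurable_EFinP.
  exact: (continuous_measurable_fun (@continuous_osc_gauss R n u v phi)).
move=> x _ /=; rewrite lee_fin [leRHS]ger0_norm ?mulr_ge0 ?expR_ge0 //.
exact: osc_gauss_bound.
Qed.

Definition osc_moment (R : realType) (n : nat) (u v phi : R) : R :=
  (\int[@lebesgue_measure R]_x osc_gauss n u v phi x)%R.

Lemma cvg_gauss_half (R : realType) (C : R) :
  C * expR (- n%:R ^+ 2 / 2) @[n --> \oo] --> (0 : R).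
Proof.
rewrite -[X in _ --> X](mulr0 C); apply: cvgMl_tmp.
under eq_fun do rewrite mulNr.
have h : (x ^+ 2 / 2 : R) @[x --> +oo] --> +oo.
  by apply: gt0_cvgMly; [rewrite invr_gt0|exact: cvgr_expr2].
exact: (cvg_comp _ _ (cvg_comp _ _ (@cvgr_idn R) h) (@cvgr_expR R)).
Qed.

(** The integral over the line of the derivative of osc_gauss vanishes. *)
Lemma osc_moment_rec (R : realType) (n : nat) (u v phi : R) :
  2 * osc_moment n.+1 u v phi =
  n%:R * osc_moment n.-1 u v phi + u * osc_moment n u v phi
  + v * osc_moment n u v (phi + pi / 2).
Proof.
pose g m psi := osc_gauss m u v psi.
pose f x := n%:R * g n.-1 phi x + u * g n phi x + v * g n (phi + pi / 2) x
  - 2 * g n.+1 phi x.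
have gi m psi := integrable_osc_gauss m u v psi.
have gZ m psi a : (@lebesgue_measure R).-integrable setT
    (EFin \o (fun x => a * g m psi x)).
  exact: (integrableZl measurableT a (gi m psi)).
have IZ m psi a : (\int[@lebesgue_measure R]_x (a * g m psi x))%R =
    a * osc_moment m u v psi.
  exact: (RintegralZl a measurableT (gi m psi)).
have i1 : (@lebesgue_measure R).-integrable setT
    (EFin \o (fun x => n%:R * g n.-1 phi x + u * g n phi x)).
  exact: (integrableD measurableT (gZ _ _ _) (gZ _ _ _)).
have i2 : (@lebesgue_measure R).-integrable setT
    (EFin \o (fun x => n%:R * g n.-1 phi x + u * g n phi x + v * g n (phi + pi / 2) x)).
  exact: (integrableD measurableT i1 (gZ _ _ _)).
have fi : (@lebesgue_measure R).-integrable setT (EFin \o f).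
  exact: (integrableB measurableT i2 (gZ _ _ _)).
have cvg0 (h : nat -> R) : (forall k, h k ^+ 2 = k%:R ^+ 2) ->
    g n phi (h k) @[k --> \oo] --> (0 : R).
  move=> hk; apply/norm_cvg0P.
  apply: (@squeeze_cvgr _ _ _ _ (cst 0)
    (fun k => n`!%:R * expR ((`|u| + 1) ^+ 2 / 2) * expR (- k%:R ^+ 2 / 2))).
  - by apply: nearW => k; rewrite normr_ge0 /= -hk osc_gauss_bound.
  - exact: cvg_cst.
  - exact: cvg_gauss_half.
have : (\int[@lebesgue_measure R]_x f x)%R = 0.
  apply: (@Rintegral_derive_eq0 _ (g n phi)) => //.
  - move=> x; apply: (is_derive_eq (is_derive_osc_gauss n u v phi x)).
    by rewrite /f /g; ring.
  - move=> x; apply: cvgB; first (apply: cvgD; first apply: cvgD);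
      by apply: cvgMl_tmp; exact: continuous_osc_gauss.
  - exact: cvg0.
  - by apply: cvg0 => k; rewrite sqrrN.
rewrite /f RintegralB // RintegralD // RintegralD // !IZ.
by move=> /eqP; rewrite subr_eq0 => /eqP ->.
Qed.

Lemma is_derive_osc_gauss_param (R : realType) (u v phi x t : R) :
  is_derive t (1 : R) (fun s : R => osc_gauss 0 (s * u) (s * v) phi x)
    (u * osc_gauss 1 (t * u) (t * v) phi x +
     v * osc_gauss 1 (t * u) (t * v) (phi + pi / 2) x).
Proof.
have d1 : is_derive t (1 : R) (fun s : R => - x ^+ 2 + s * u * x) (u * x).
  by apply: is_derive_eq; rewrite /GRing.scale /=; ring.
have d2 : is_derive t (1 : R) (fun s : R => s * v * x + phi) (v * x).
  by apply: is_derive_eq; rewrite /GRing.scale /=; ring.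
have d3 := @is_derive1_comp _ expR _ t _ _ (is_derive_expR _) d1.
have d4 := @is_derive1_comp _ cos _ t _ _ (is_derive_cos _) d2.
have := is_deriveM d3 d4.
have -> : (fun s : R => osc_gauss 0 (s * u) (s * v) phi x) =
    (expR \o (fun s : R => - x ^+ 2 + s * u * x)) * (cos \o (fun s : R => s * v * x + phi)).
  by apply/funext => s; rewrite /osc_gauss !fctE /= mul1r.
move=> h; apply: (is_derive_eq h); rewrite /GRing.scale /= /osc_gauss.
rewrite addrA cosDpihalf; ring.
Qed.

Lemma osc_moment_pi (R : realType) (n : nat) (u v phi : R) :
  osc_moment n u v (phi + pi) = - osc_moment n u v phi.
Proof.
rewrite -mulN1r /osc_moment -(RintegralZl (-1) measurableT (integrable_osc_gauss _ _ _ _)).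
apply: eq_Rintegral => x _; rewrite /osc_gauss addrA cosDpi; ring.
Qed.

(** Differentiating under the integral inserts a factor x, that is, raises the
moment from 0 to 1, and osc_moment_rec brings it back to 0.  In complex terms
this is J' = (t b^2/2) J, for J(t) the integral of exp(-x^2 + t b x) and
b = u + i v. *)
Lemma is_derive_osc_moment (R : realType) (u v phi t : R) :
  is_derive t (1 : R) (fun s : R => osc_moment 0 (s * u) (s * v) phi)
    (t / 2 * ((u ^+ 2 - v ^+ 2) * osc_moment 0 (t * u) (t * v) phi +
              2 * u * v * osc_moment 0 (t * u) (t * v) (phi + pi / 2))).
Proof.
pose f (s x : R) := osc_gauss 0 (s * u) (s * v) phi x.
have d1f s x : partial1of2 f s x = u * osc_gauss 1 (s * u) (s * v) phi x +
     v * osc_gauss 1 (s * u) (s * v) (phi + pi / 2) x.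
  rewrite partial1of2E.
  by have h := is_derive_osc_gauss_param u v phi x s; rewrite derive_val.
(* the bound on |s u| for s in ]t - 1, t + 1[ *)
pose U := (`|t| + 1) * `|u|.
pose C := (`|u| + `|v|) * expR ((U + 1) ^+ 2 / 2).
pose G x : R := C * expR (- x ^+ 2 / 2).
have C0 : 0 <= C by rewrite mulr_ge0 ?expR_ge0 ?addr_ge0.
have G0 x : 0 <= G x by rewrite mulr_ge0 ?expR_ge0.
have Gi : (@lebesgue_measure R).-integrable setT (EFin \o G).
  exact: (integrableZl measurableT C (@integrable_gauss_half R)).
have tI : `]t - 1, t + 1[%classic t.
  by rewrite /= in_itv /= ltrBlDr ltrDl ltr01.
have fi s : (@lebesgue_measure R).-integrable setT (EFin \o f s).
  exact: integrable_osc_gauss.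
have df s x : derivable (f ^~ x) s 1.
  by have h := is_derive_osc_gauss_param u v phi x s.
have Gub s x : `]t - 1, t + 1[%classic s -> setT x -> `|partial1of2 f s x| <= G x.
  rewrite /= in_itv /= => /andP[s1 s2] _; rewrite d1f.
  have sU : `|s * u| <= U.
    rewrite normrM ler_wpM2r //.
    have : `|s - t| <= 1 by rewrite ler_distl; apply/andP; split; lra.
    by have := ler_normD (s - t) t; rewrite subrK; lra.
  have h psi := osc_gauss_bound 1 (s * v) psi x sU.
  rewrite (le_trans (ler_normD _ _)) // (normrM u) (normrM v).
  rewrite /G /C -[leRHS]mulrA [leRHS]mulrDl.
  by rewrite lerD // ler_wpM2l // (le_trans (h _)) // mul1r.
have der := derivable_under_integral measurableT tI (fun s _ => fi s)
  (fun s x _ _ => df s x) G0 Gi Gub.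
have val := differentiation_under_integral measurableT tI (fun s _ => fi s)
  (fun s x _ _ => df s x) G0 Gi Gub.
apply: DeriveDef; first exact: der.
rewrite -derive1E val.
have gi m psi := integrable_osc_gauss m (t * u) (t * v) psi.
have gZ psi a : (@lebesgue_measure R).-integrable setT
    (EFin \o (fun x => a * osc_gauss 1 (t * u) (t * v) psi x)).
  exact: (integrableZl measurableT a (gi _ psi)).
have rec psi : osc_moment 1 (t * u) (t * v) psi =
    (t * u * osc_moment 0 (t * u) (t * v) psi +
     t * v * osc_moment 0 (t * u) (t * v) (psi + pi / 2)) / 2.
  by have := osc_moment_rec 0 (t * u) (t * v) psi; rewrite mul0r => h; lra.
transitivity (u * osc_moment 1 (t * u) (t * v) phi +
              v * osc_moment 1 (t * u) (t * v) (phi + pi / 2)).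
  rewrite /osc_moment -!RintegralZl //.
  rewrite -(RintegralD measurableT (gZ _ _) (gZ _ _)).
  by apply: eq_Rintegral => x _; rewrite d1f.
by rewrite !rec -addrA -splitr osc_moment_pi; field.
Qed.

(** With J(t) the integral of exp(-x^2 + t b x) and b = u + i v, the product
J(t) exp(- t^2 b^2/4) has zero derivative, and J(0) is the Gauss integral. *)
Lemma osc_moment_eval (R : realType) (u v phi : R) :
  osc_moment 0 u v phi =
  Num.sqrt pi * expR ((u ^+ 2 - v ^+ 2) / 4) * cos (phi + u * v / 2).
Proof.
pose c := (u ^+ 2 - v ^+ 2) / 4; pose d := u * v / 2.
pose J psi t := osc_moment 0 (t * u) (t * v) psi.
(* real part of exp(i psi) J(t) exp(- t^2 b^2/4), as b^2/4 = c + i d *)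
pose K psi t := expR (- c * t ^+ 2) *
  (J psi t * cos (d * t ^+ 2) - J (psi + pi / 2) t * sin (d * t ^+ 2)).
have dK psi t : is_derive t (1 : R) (K psi) 0.
  have dJ := is_derive_osc_moment u v psi t.
  have := is_derive_osc_moment u v (psi + pi / 2) t.
  rewrite -(addrA psi) -splitr osc_moment_pi => dJ'.
  have dq a : is_derive t (1 : R) (fun s : R => a * s ^+ 2) (2 * a * t).
    by apply: is_derive_eq; rewrite /GRing.scale /=; ring.
  have de := @is_derive1_comp _ expR _ t _ _ (is_derive_expR _) (dq (- c)).
  have dc := @is_derive1_comp _ cos _ t _ _ (is_derive_cos _) (dq d).
  have ds := @is_derive1_comp _ sin _ t _ _ (is_derive_sin _) (dq d).
  have h := is_deriveM de (is_deriveB (is_deriveM dJ dc) (is_deriveM dJ' ds)).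
  by apply: (is_derive_eq h); rewrite !fctE /GRing.scale /= /c /d; field.
have J0 psi : J psi 0 = Num.sqrt pi * cos psi.
  rewrite /J /osc_moment !mul0r.
  transitivity (\int[@lebesgue_measure R]_x (cos psi * gauss_fun x))%R.
    apply: eq_Rintegral => x _.
    by rewrite /osc_gauss !mul0r add0r addr0 mul1r mulrC.
  rewrite (RintegralZl _ measurableT (@integrableT_gauss R)) mulrC.
  by rewrite /Rintegral integralT_gauss.
have K1 psi : K psi 1 = Num.sqrt pi * cos psi.
  rewrite (is_derive_0_is_cst 1 0 (dK psi)) /K expr0n /= !mulr0 expR0 cos0 sin0.
  by rewrite mulr0 subr0 mulr1 mul1r J0.
have K1E psi : J psi 1 * cos d - J (psi + pi / 2) 1 * sin d =
    Num.sqrt pi * expR c * cos psi.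
  have := K1 psi; rewrite /K expr1n !mulr1 expRN => /(congr1 (fun x => expR c * x)).
  by rewrite mulrA divff ?expR_eq0 // mul1r => ->; ring.
have e1 := K1E phi; have := K1E (phi + pi / 2).
rewrite -addrA -splitr cosDpihalf {2}/J osc_moment_pi -/(J phi 1).
have -> : osc_moment 0 u v phi = J phi 1 by rewrite /J !mul1r.
rewrite -/c -/d cosD => e2; have := cos2Dsin2 d => cs.
set x := J phi 1 in e1 e2 *; rewrite -[LHS]mulr1 -[X in _ * X]cs.
(* invert the rotation by d formed by the equations e1 and e2 *)
transitivity (cos d * (x * cos d - J (phi + pi / 2) 1 * sin d) +
              sin d * (J (phi + pi / 2) 1 * cos d - - x * sin d)); first ring.
by rewrite e1 e2; ring.
Qed.

(** * Complex Gaussian integrals *)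

Lemma expCD (R : realType) (x y : R[i]) : expC (x + y) = expC x * expC y.
Proof.
case: x y => [a b] [c d]; rewrite /expC /=; simpc.
by rewrite expRD cosD sinD; congr (_ +i* _); ring.
Qed.

Lemma conjcE (R : realType) (x : R[i]) : (x^*)%C = (x^*)%R.
Proof. by []. Qed.

Lemma conj_real_complex (R : realType) (x : R) : (x%:C^*)%R = x%:C.
Proof. exact: conjc_real. Qed.

Lemma expC_conj (R : realType) (x : R[i]) : ((expC x)^*)%R = expC (x^*)%R.
Proof.
rewrite -!conjcE; case: x => a b; rewrite /expC /=; simpc.
by rewrite cosN sinN mulrN.
Qed.

Definition Cintegrable (R : realType) (f : R -> R[i]) : Prop :=
  (@lebesgue_measure R).-integrable setT (EFin \o (fun x => complex.Re (f x))) /\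
  (@lebesgue_measure R).-integrable setT (EFin \o (fun x => complex.Im (f x))).

Lemma CintegrableD (R : realType) (f g : R -> R[i]) :
  Cintegrable f -> Cintegrable g -> Cintegrable (fun x => f x + g x).
Proof.
move=> [f1 f2] [g1 g2]; split.
  have -> : (fun x => complex.Re (f x + g x)) =
      (fun x => complex.Re (f x) + complex.Re (g x)).
    by apply/funext => x; case: (f x) (g x) => [a b] [c d].
  exact: (integrableD measurableT f1 g1).
have -> : (fun x => complex.Im (f x + g x)) =
    (fun x => complex.Im (f x) + complex.Im (g x)).
  by apply/funext => x; case: (f x) (g x) => [a b] [c d].
exact: (integrableD measurableT f2 g2).
Qed.

Lemma CintegralD (R : realType) (f g : R -> R[i]) :
  Cintegrable f -> Cintegrable g ->
  Cintegral (fun x => f x + g x) = Cintegral f + Cintegral g.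
Proof.
move=> [f1 f2] [g1 g2]; rewrite /Cintegral; simpc.
rewrite -(RintegralD measurableT f1 g1) -(RintegralD measurableT f2 g2).
by congr (_ +i* _); apply: eq_Rintegral => x _; case: (f x) (g x) => [a b] [c d].
Qed.

Lemma CintegrableZl (R : realType) (k : R[i]) (f : R -> R[i]) :
  Cintegrable f -> Cintegrable (fun x => k * f x).
Proof.
move=> [f1 f2]; have Z a := integrableZl measurableT a f1.
have Z' a := integrableZl measurableT a f2.
case: k => a b; split.
  have -> : (fun x => complex.Re ((a +i* b) * f x)) =
      (fun x => a * complex.Re (f x) - b * complex.Im (f x)).
    by apply/funext => x; case: (f x) => c d.
  exact: (integrableB measurableT (Z a) (Z' b)).
have -> : (fun x => complex.Im ((a +i* b) * f x)) =
    (fun x => a * complex.Im (f x) + b * complex.Re (f x)).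
  by apply/funext => x; case: (f x) => c d.
exact: (integrableD measurableT (Z' a) (Z b)).
Qed.

Lemma CintegralZl (R : realType) (k : R[i]) (f : R -> R[i]) :
  Cintegrable f -> Cintegral (fun x => k * f x) = k * Cintegral f.
Proof.
move=> [f1 f2]; have Z a := integrableZl measurableT a f1.
have Z' a := integrableZl measurableT a f2.
case: k => a b; rewrite /Cintegral; simpc.
rewrite -(RintegralZl a measurableT f1) -(RintegralZl b measurableT f1).
rewrite -(RintegralZl a measurableT f2) -(RintegralZl b measurableT f2).
rewrite -(RintegralB measurableT (Z a) (Z' b)) -(RintegralD measurableT (Z' a) (Z b)).
by congr (_ +i* _); apply: eq_Rintegral => x _; case: (f x) => [c d].
Qed.

(** The phase - pi/2 turns the cosine into the sine of the imaginary part. *)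
Lemma monomial_waveE (R : realType) (n : nat) (b : R[i]) (x : R) :
  x%:C ^+ n * expC (- x%:C ^+ 2 + b * x%:C) =
  osc_gauss n (complex.Re b) (complex.Im b) 0 x +i*
  osc_gauss n (complex.Re b) (complex.Im b) (- (pi / 2)) x.
Proof.
case: b => u v /=; rewrite -!rmorphXn /= /osc_gauss addr0 cosBpihalf.
rewrite /expC; simpc. by rewrite /= !mulrA.
Qed.

Lemma Cintegrable_monomial_wave (R : realType) (n : nat) (b : R[i]) :
  Cintegrable (fun x : R => x%:C ^+ n * expC (- x%:C ^+ 2 + b * x%:C)).
Proof.
by split; under eq_fun do rewrite /= monomial_waveE; exact: integrable_osc_gauss.
Qed.

Lemma Cintegral_monomial_wave_rec (R : realType) (n : nat) (b : R[i]) :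
  let M n := Cintegral (fun x : R => x%:C ^+ n * expC (- x%:C ^+ 2 + b * x%:C)) in
  M n.+1 = b / 2 * M n + n%:R * M n.-1 / 2.
Proof.
move=> M; pose u := complex.Re b; pose v := complex.Im b.
have ME m : M m = osc_moment m u v 0 +i* osc_moment m u v (- (pi / 2)).
  rewrite /M /Cintegral /osc_moment.
  by congr (_ +i* _); apply: eq_Rintegral => x _; rewrite monomial_waveE.
have e1 := osc_moment_rec n u v 0; have e2 := osc_moment_rec n u v (- (pi / 2)).
have {}e1 : 2 * osc_moment n.+1 u v 0 = n%:R * osc_moment n.-1 u v 0 +
    u * osc_moment n u v 0 - v * osc_moment n u v (- (pi / 2)).
  rewrite e1 add0r -mulrN -osc_moment_pi; congr (_ + v * osc_moment n u v _).
  by field.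
rewrite addNr in e2.
have h : 2 * M n.+1 = b * M n + n%:R * M n.-1.
  rewrite !ME; have -> : b = u +i* v by rewrite /u /v; case: (b).
  have nC (k : nat) : k%:R = (k%:R : R) +i* 0 :> R[i].
    by rewrite -[RHS]/(k%:R%:C) rmorph_nat.
  rewrite !nC; simpc; rewrite e1 e2.
  by congr (_ +i* _); ring.
apply: (@mulfI _ 2); first by rewrite pnatr_eq0.
by rewrite h; field.
Qed.

Lemma Cintegral_wave (R : realType) (b : R[i]) :
  Cintegral (fun x : R => expC (- x%:C ^+ 2 + b * x%:C)) =
  (Num.sqrt pi)%:C * expC (b ^+ 2 / 4).
Proof.
have -> : Cintegral (fun x : R => expC (- x%:C ^+ 2 + b * x%:C)) =
    osc_moment 0 (complex.Re b) (complex.Im b) 0 +i*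
    osc_moment 0 (complex.Re b) (complex.Im b) (- (pi / 2)).
  rewrite /Cintegral /osc_moment.
  by congr (_ +i* _); apply: eq_Rintegral => x _; rewrite -[expC _]mul1r -(expr0 x%:C) monomial_waveE.
rewrite !osc_moment_eval add0r [- _ + _]addrC cosBpihalf.
case: b => u v /=.
have -> : (u +i* v) ^+ 2 / 4 = ((u ^+ 2 - v ^+ 2) / 4) +i* (u * v / 2).
  apply: (@mulIf _ 4); first by rewrite pnatr_eq0.
  rewrite mulfVK ?pnatr_eq0 //.
  have -> : 4 = (4 : R)%:C by rewrite rmorph_nat.
  rewrite expr2; simpc; congr (_ +i* _); by field.
by rewrite /expC /=; simpc; rewrite !mulrA.
Qed.

Definition wave_functional (R : realType) (b : R[i]) (P : {poly R[i]}) : R[i] :=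
  Cintegral (fun x : R => P.[x%:C] * expC (- x%:C ^+ 2 + b * x%:C)).

Lemma Cintegrable_poly_wave (R : realType) (b : R[i]) (P : {poly R[i]}) :
  Cintegrable (fun x : R => P.[x%:C] * expC (- x%:C ^+ 2 + b * x%:C)).
Proof.
under eq_fun do rewrite horner_coef.
elim: (size P) => [|n ih].
  under eq_fun do rewrite big_ord0.
  rewrite (_ : (fun x => _) = fun x : R => 0 * (x%:C ^+ 0 * expC (- x%:C ^+ 2 + b * x%:C))).
    exact/CintegrableZl/Cintegrable_monomial_wave.
  by apply/funext => x; rewrite !mul0r.
under eq_fun do rewrite big_ord_recr /= mulrDl -mulrA.
exact/(CintegrableD ih)/CintegrableZl/Cintegrable_monomial_wave.
Qed.

Lemma wave_functional_is_scalar (R : realType) (b : R[i]) :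
  scalar (@wave_functional R b).
Proof.
move=> a P Q; rewrite /wave_functional.
have iP := Cintegrable_poly_wave b P; have iQ := Cintegrable_poly_wave b Q.
rewrite -(CintegralZl a iP) -(CintegralD (CintegrableZl a iP) iQ).
congr Cintegral; apply/funext => x.
rewrite hornerD hornerZ mulrDl.
by rewrite -(mulrA a).
Qed.

HB.instance Definition _ (R : realType) (b : R[i]) :=
  GRing.isLinear.Build R[i] {poly R[i]} R[i] _ (@wave_functional R b)
    (@wave_functional_is_scalar R b).

(** Both sides are linear in P, and on monomials this is the recurrence of the
moments. *)
Lemma wave_functional_mulX (R : realType) (b : R[i]) (P : {poly R[i]}) :
  wave_functional b ('X * P) =
  b / 2 * wave_functional b P + wave_functional b P^`() / 2.
Proof.
have LZ a Q : wave_functional b (a *: Q) = a * wave_functional b Q.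
  by rewrite linearZ.
have LXn n : wave_functional b 'X^n =
    Cintegral (fun x : R => x%:C ^+ n * expC (- x%:C ^+ 2 + b * x%:C)).
  by congr Cintegral; apply/funext => x; rewrite hornerXn.
rewrite -[P]coefK poly_def mulr_sumr !raddf_sum /=.
rewrite mulr_sumr mulr_suml -big_split /=; apply: eq_bigr => i _.
rewrite derivZ derivXn -scalerAr -exprS !LZ.
rewrite raddfMn /= !LXn Cintegral_monomial_wave_rec -[_ *+ i]mulr_natl; ring.
Qed.

Lemma wave_functional1 (R : realType) (b : R[i]) :
  wave_functional b 1 = (Num.sqrt pi)%:C * expC (b ^+ 2 / 4).
Proof.
rewrite -Cintegral_wave; congr Cintegral; apply/funext => x.
by rewrite hornerC mul1r.
Qed.

(** * The integrals I_{a,m} and their sum *)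

Lemma pi_quartic_root (R : realType) :
  (pi `^ (- 4^-1)) ^+ 2 * Num.sqrt pi = 1 :> R.
Proof.
have p0 : pi != 0 :> R by rewrite gt_eqF // pi_gt0.
rewrite -powR12_sqrt ?pi_ge0 // expr2 -!powRD ?p0 ?implybT //.
by rewrite (_ : _ + _ = 0) ?powRr0 //; field.
Qed.

(** Collects the two Gaussian exponents into one quadratic in x, with the
constant part split off. *)
Lemma segal_bargmann_mul (R : realType) (a : R) (z w : R[i]) (x : R) :
  let s2 := (Num.sqrt 2)%:C : R[i] in
  segal_bargmann z x * ((segal_bargmann w (x - a))^*)%R =
  ((pi `^ (- 4^-1)) ^+ 2)%:C *
  expC (- (a%:C ^+ 2 + z ^+ 2 + (w^*)%R ^+ 2) / 2 - s2 * (w^*)%R * a%:C) *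
  expC (- x%:C ^+ 2 + (a%:C + s2 * (z + (w^*)%R)) * x%:C).
Proof.
move=> s2; rewrite /segal_bargmann.
set k : R := pi `^ _.
rewrite rmorphM /= expC_conj conj_real_complex mulrACA -expCD -[RHS]mulrA -expCD.
rewrite -rmorphM -expr2; congr (_ * expC _).
rewrite rmorphD !rmorphM rmorphN fmorphV rmorph_nat rmorphD !rmorphXn /=.
rewrite !conj_real_complex rmorphB /= -/s2.
by field.
Qed.

Lemma hermite_map (R : realType) (H : nat -> {poly R}) (hH : is_hermite H) :
  let h m := map_poly (real_complex R) (H m) in
  [/\ h 0%N = 1,
      forall m, h m.+1 = 2 *: 'X * h m - (2 * m%:R) *: h m.-1 &
      forall m, (h m)^`() = (2 * m%:R) *: h m.-1].
Proof.
have nC (k : nat) : (2 * k%:R : R)%:C = 2 * k%:R :> R[i].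
  by rewrite rmorphM !rmorph_nat.
move=> h; split=> [|m|m]; rewrite /h.
- by rewrite (hermite0 hH) rmorph1.
- rewrite (hermiteS _ hH) rmorphB rmorphM /= !map_polyZ /= map_polyX nC.
  by rewrite rmorph_nat.
- by rewrite deriv_map (deriv_hermite _ hH) map_polyZ /= nC.
Qed.

Lemma I_int_wave (R : realType) (H : nat -> {poly R}) (a : R) (m : nat)
    (z w : R[i]) :
  let s2 := (Num.sqrt 2)%:C : R[i] in
  let h := map_poly (real_complex R) (H m) in
  I_int H a m z w =
  ((pi `^ (- 4^-1)) ^+ 2)%:C *
  expC (- (a%:C ^+ 2 + z ^+ 2 + (w^*)%R ^+ 2) / 2 - s2 * (w^*)%R * a%:C) *
  wave_functional (a%:C + s2 * (z + (w^*)%R))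
    ((h \Po (((z + (z^*)%R) / s2)%:P - 'X)) *
     (h \Po (((w + (w^*)%R) / s2 + a%:C)%:P - 'X))).
Proof.
move=> s2 h; rewrite /wave_functional /I_int.
rewrite -(CintegralZl _ (Cintegrable_poly_wave _ _)).
congr Cintegral; apply/funext => x.
rewrite -mulrA segal_bargmann_mul hornerM !horner_comp.
rewrite !(hornerD, hornerN, hornerC, hornerX) -/s2 -/h.
have -> : (w + (w^*)%R) / s2 + a%:C - x%:C = (w + (w^*)%R) / s2 - x%:C + a%:C by ring.
by ring.
Qed.

Unset Implicit Arguments.
Set Strict Implicit.
Set Printing Implicit Defensive.

Theorem proposition6p18 (R : realType) (H : nat -> {poly R})
    (hH : is_hermite H) (N : nat) (a : R) (z w : R[i]) :
  S_sum H a N z w =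
  expC (- (a%:C ^+ 2 / 4) + z * a%:C / (Num.sqrt 2)%:C) *
  fock_kernel N.+1 (z - a%:C / (Num.sqrt 2)%:C) w.
Proof.
have [h0 hS dh] := hermite_map hH.
set s2 : R[i] := (Num.sqrt 2)%:C.
have s22 : s2 ^+ 2 = 2 by rewrite /s2 -rmorphXn /= sqr_sqrtr // rmorph_nat.
have s20 : s2 != 0.
  by apply/eqP => e; move: s22; rewrite e expr0n /= => /esym/eqP; rewrite pnatr_eq0.
pose b := a%:C + s2 * (z + (w^*)%R).
pose g := - (a%:C ^+ 2 + z ^+ 2 + (w^*)%R ^+ 2) / 2 - s2 * (w^*)%R * a%:C.
pose s := (z + (z^*)%R) / s2 - b / 2.
pose t := (w + (w^*)%R) / s2 + a%:C - b / 2.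
(* The two normalisations of the kernels cancel the Gauss integral. *)
have piC : ((pi `^ (- 4^-1)) ^+ 2)%:C * (Num.sqrt pi)%:C = 1 :> R[i].
  by rewrite -rmorphM /= pi_quartic_root.
have I_E m : I_int H a m z w =
    expC (g + b ^+ 2 / 4) * \sum_(k < m.+1) hermite_moment s t m m k.
  rewrite I_int_wave.
  rewrite (gaussian_functional_hermite _ _ _ _ (@wave_functional_mulX R b) h0 hS dh).
  rewrite /= wave_functional1 -/g -/s -/t (expCD g) -[RHS]mul1r -piC.
  by ring.
have -> : S_sum H a N z w = expC (g + b ^+ 2 / 4) * (laguerre R[i] 1 N).[- (2 * s * t)].
  rewrite -sum_hermite_moment_laguerre mulr_sumr.
  by apply: eq_bigr => m _; rewrite I_E mulrCA.
rewrite /fock_kernel mulrA -expCD /=; congr (expC _ * _.[_]).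
  have -> : b ^+ 2 / 4 = a%:C ^+ 2 / 4 + s2 * a%:C * (z + (w^*)%R) / 2 +
      (z + (w^*)%R) ^+ 2 / 2.
    transitivity (a%:C ^+ 2 / 4 + s2 * a%:C * (z + (w^*)%R) / 2 +
      s2 ^+ 2 * (z + (w^*)%R) ^+ 2 / 4); first by rewrite /b; field.
    by rewrite s22; field.
  have -> : z * a%:C / s2 = z * (a%:C / s2) by rewrite mulrA.
  have -> : a%:C / s2 = s2 * a%:C / 2 by rewrite -s22; field.
  by rewrite /g; field.
have conj_zeta : ((z - a%:C / s2 - w)^*)%C = (z^*)%R - a%:C / s2 - (w^*)%R.
  by rewrite conjcE !rmorphB fmorph_div /= !conj_real_complex.
rewrite sqr_normc conj_zeta.
have s2V : s2^-1 = s2 / 2 by rewrite -s22; field.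
by rewrite /s /t /b s2V; field: s22.
Qed.
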